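(* Let $M$ be a matroid with a cycle system $\mathcal{C}=\{C_1,\dots,C_g\}$, where $g=g(M)$, and let $P^*=P^*(\mathcal{C})\subseteq\mathbb{N}^g$ be the set of coparking functions with respect to $\mathcal{C}$. 1. (Dhar-type algorithm.) Given $a=(a_1,\dots,a_g)\in\mathbb{N}^g$, consider the following procedure. Start with $\sigma=[g]$. While $\sigma\neq\emptyset$: if there exists $i\in\sigma$ with $a_i<|C_i\cap\mathcal{C}_\sigma|$, choose any such $i$ and replace $\sigma$ by $\sigma\setminus\{i\}$; if no such $i$ exists, stop and output FALSE. If $\sigma=\emptyset$ is reached, output TRUE. Then, for any choices made, the procedure terminates, and it outputs TRUE if and only if $a$ is a coparking function with respect to $\mathcal{C}$. 2. The poset $P^*(\mathcal{C})$ is a pure multicomplex. 3. The degree vector of $P^*$ is the $h$-vector of $M$, i.e. $\deg(P^* )=h(M)$.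
   Context: Matroids are on finite ground sets; $E(M)$ is the ground set, $r(M)$ the rank, and $g(M)=|E(M)|-r(M)$ the corank. $\mathbb{N}$ includes $0$, and $\mathbb{N}^0=\{()\}$. A *cycle* of $M$ is a union of circuits of $M$. Unique union: for a family $\mathcal{A}=\{A_1,\dots,A_g\}$ of subsets of a set and $\sigma\subseteq[g]=\{1,\dots,g\}$, $\mathcal{A}_\sigma$ is the set of elements $e\in\bigcup_{i\in\sigma}A_i$ for which there is exactly one $i\in\sigma$ with $e\in A_i$. A *cycle system* for $M$ is a collection $\mathcal{C}=\{C_1,\dots,C_g\}$ of cycles of $M$ with $g=g(M)$ such that for every nonempty $\sigma\subseteq[g]$ the unique union $\mathcal{C}_\sigma$ is dependent in $M$. A *coparking function* with respect to $\mathcal{C}$ is a vector $a=(a_1,\dots,a_g)\in\mathbb{N}^g$ such that for every nonempty $\sigma\subseteq[g]$ there is some $i\in\sigma$ with $a_i<|C_i\cap\mathcal{C}_\sigma|$ (if $g=0$, the only one is $()$). Order $\mathbb{N}^g$ componentwise and put $\deg(a)=\sum_i a_i$ (so $\deg(())=0$). A *multicomplex* is (identified with) a finite order ideal of $\mathbb{N}^g$, i.e. a finite subset closed under passing to componentwise smaller vectors; it is *pure* if all its maximal elements have the same degree. The *degree vector* of a multicomplex is $(d_0,d_1,\dots)$ with $d_i$ the number of its elements of degree $i$. The $h$-vector $h(M)=(h_0,\dots,h_d)$, $d=r(M)$, is defined by $\sum_{k=0}^d h_k t^{d-k}=\sum_{i=0}^d f_{i-1}(t-1)^{d-i}$, where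 $f_{i-1}$ is the number of independent sets of $M$ of size $i$. Degree vectors and $h$-vectors are compared disregarding trailing zeros. *)

(* Defs.v *)
From mathcomp Require Import all_boot all_order all_algebra.
From Stdlib Require Import Relation_Operators.

Set Implicit Arguments.
Unset Strict Implicit.
Unset Printing Implicit Defensive.

Import Order.TTheory GRing.Theory Num.Theory.

(* The ground set E(M) is the whole type E. *)
Record matroid (E : finType) := Matroid {
  indep : pred {set E};
  indep_set0 : indep set0;
  indep_sub : forall I J : {set E}, I \subset J -> indep J -> indep I;
  indep_aug : forall I J : {set E}, indep I -> indep J -> #|I| < #|J| ->
    exists2 e, e \in J :\: I & indep (e |: I)
}.

Definition dependent (E : finType) (M : matroid E) (X : {set E}) : bool :=
  ~~ indep M X.

Definition rank (E : finType) (M : matroid E) : nat :=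
  \max_(I : {set E} | indep M I) #|I|.

Definition corank (E : finType) (M : matroid E) : nat := #|E| - rank M.

Definition circuit (E : finType) (M : matroid E) (X : {set E}) : bool :=
  minset (dependent M) X.

Definition cycle (E : finType) (M : matroid E) (X : {set E}) : Prop :=
  exists2 S : {set {set E}}, (forall Y, Y \in S -> circuit M Y) & X = cover S.

Definition unique_union (E : finType) (g : nat) (A : 'I_g -> {set E})
    (sigma : {set 'I_g}) : {set E} :=
  [set e | #|[set i in sigma | e \in A i]| == 1].

(* The sets C i are automatically distinct: if C i = C j with i != j, the
   unique union over [set i; j] is empty, hence independent. *)
Definition cycle_system (E : finType) (M : matroid E)
    (C : 'I_(corank M) -> {set E}) : Prop :=
  (forall i, cycle M (C i)) /\
  (forall sigma, sigma != set0 -> dependent M (unique_union C sigma)).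

Definition coparking (E : finType) (g : nat) (C : 'I_g -> {set E}) :
    pred {ffun 'I_g -> nat} :=
  fun a => [forall sigma : {set 'I_g}, (sigma != set0) ==>
    [exists i in sigma, a i < #|C i :&: unique_union C sigma|]].

Inductive dhar_state (g : nat) : Type :=
  | Running of {set 'I_g}
  | Output of bool.
Arguments Output {g} _.

Inductive dhar_step (E : finType) (g : nat) (C : 'I_g -> {set E})
    (a : {ffun 'I_g -> nat}) : dhar_state g -> dhar_state g -> Prop :=
  | dhar_remove (sigma : {set 'I_g}) (i : 'I_g) :
      i \in sigma -> a i < #|C i :&: unique_union C sigma| ->
      dhar_step C a (Running sigma) (Running (sigma :\ i))
  | dhar_fail (sigma : {set 'I_g}) :
      sigma != set0 ->
      (forall i, i \in sigma -> ~ a i < #|C i :&: unique_union C sigma|) ->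
      dhar_step C a (Running sigma) (Output false)
  | dhar_success : dhar_step C a (Running set0) (Output true).

Definition dhar_terminates (E : finType) (g : nat) (C : 'I_g -> {set E})
    (a : {ffun 'I_g -> nat}) : Prop :=
  Acc (fun s' s => dhar_step C a s s') (Running [set: 'I_g]).

(* s is the last state of some run that cannot be continued *)
Definition dhar_final (E : finType) (g : nat) (C : 'I_g -> {set E})
    (a : {ffun 'I_g -> nat}) (s : dhar_state g) : Prop :=
  clos_refl_trans _ (dhar_step C a) (Running [set: 'I_g]) s /\
  (forall s', ~ dhar_step C a s s').

Definition vec_le (g : nat) (a b : {ffun 'I_g -> nat}) : Prop :=
  forall i, a i <= b i.

Definition deg (g : nat) (a : {ffun 'I_g -> nat}) : nat := \sum_(i < g) a i.

Definition multicomplex (g : nat) (P : pred {ffun 'I_g -> nat}) : Prop :=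
  (exists s : seq {ffun 'I_g -> nat}, forall a, P a -> a \in s) /\
  (forall a b, vec_le a b -> P b -> P a).

Definition maximal (g : nat) (P : pred {ffun 'I_g -> nat})
    (a : {ffun 'I_g -> nat}) : Prop :=
  P a /\ (forall b, P b -> vec_le a b -> b = a).

Definition pure (g : nat) (P : pred {ffun 'I_g -> nat}) : Prop :=
  forall a b, maximal P a -> maximal P b -> deg a = deg b.

(* The vectors of degree k all have entries in {0, ..., k}, so they can be
   counted inside the finite type {ffun 'I_g -> 'I_k.+1}; see
   degree_vectorE. *)
Definition degree_vector (g : nat) (P : pred {ffun 'I_g -> nat}) (k : nat) :
    nat :=
  #|[set a : {ffun 'I_g -> 'I_k.+1} |
      let b := [ffun i => nat_of_ord (a i)] in P b && (deg b == k)]|.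

Lemma degree_vectorE (g : nat) (P : pred {ffun 'I_g -> nat})
    (s : seq {ffun 'I_g -> nat}) (k : nat) :
  uniq s -> (forall a, (a \in s) = P a) ->
  degree_vector P k = count (fun a => deg a == k) s.
Proof.
move=> us sP; rewrite /degree_vector.
pose f (a : {ffun 'I_g -> 'I_k.+1}) := [ffun i => nat_of_ord (a i)].
have f_inj : injective f.
  move=> a b /ffunP eab; apply/ffunP => i; apply/val_inj.
  by have := eab i; rewrite !ffunE.
rewrite cardE -(size_map f) -size_filter; apply/perm_size/uniq_perm.
- by rewrite map_inj_uniq ?enum_uniq.
- exact: filter_uniq.
move=> b; rewrite mem_filter sP; apply/mapP/andP => [[a]|[db Pb]].
  by rewrite mem_enum inE /= => /andP[Pa da] ->.
have fb : f [ffun i => inord (b i)] = b.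
  apply/ffunP => i; rewrite !ffunE inordK // ltnS -(eqP db) /deg.
  by rewrite (bigD1 i) //= leq_addr.
exists [ffun i => inord (b i)]; last by rewrite fb.
by rewrite mem_enum inE /= -/(f _) fb Pb.
Qed.

Definition num_indep (E : finType) (M : matroid E) (i : nat) : nat :=
  #|[set I : {set E} | indep M I & #|I| == i]|.

Local Open Scope ring_scope.

Definition h_poly (E : finType) (M : matroid E) : {poly int} :=
  \sum_(i < (rank M).+1) (num_indep M i)%:R *: ('X - 1) ^+ (rank M - i).

(* The guard is needed because rank M - k is truncated at 0. *)
Definition h_vector (E : finType) (M : matroid E) (k : nat) : int :=
  if (k <= rank M)%N then (h_poly M)`_(rank M - k) else 0.

Lemma h_vectorE (E : finType) (M : matroid E) :
  \sum_(k < (rank M).+1) h_vector M k *: 'X^(rank M - k) =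
  \sum_(i < (rank M).+1) (num_indep M i)%:R *: ('X - 1) ^+ (rank M - i)
    :> {poly int}.
Proof.
rewrite -[RHS]/(h_poly M).
have size_h : (size (h_poly M) <= (rank M).+1)%N.
  apply/(leq_trans (size_sum _ _ _))/bigmax_leqP => i _.
  apply: leq_trans (size_scale_leq _ _) _.
  by rewrite -polyC1 size_exp_XsubC ltnS leq_subr.
transitivity (\poly_(j < (rank M).+1) (h_poly M)`_j).
  rewrite poly_def (reindex_inj rev_ord_inj) /=; apply: eq_bigr => i _.
  have le_i : (i <= rank M)%N by rewrite -ltnS.
  by rewrite subSS /h_vector leq_subr subKn.
apply/polyP => j; rewrite coef_poly; case: ltnP => // lt_j.
by rewrite nth_default // (leq_trans size_h).
Qed.

(* Main.v *)
(* Deletion-contraction along an element e that lies in exactly one C_j.  As e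
   is in C_sigma for every sigma containing j, the coparking functions with
   a_j = 0 are those of C without C_j on M \ e, and lowering a_j by one
   identifies the others with those of the sets C_i - e on M / e; this is the
   recursion h_k(M) = h_k(M \ e) + h_(k-1)(M / e).  When e is a loop the second
   kind cannot occur, since g cycles with nonempty unique unions need corank at
   least g.  Every maximal coparking function has degree r(M) - #coloops: if f
   is a coloop of M \ e but not of M, then f also lies only in C_j, so a
   coparking function with a_j = 0 is not maximal. *)
Require Import Defs.
From mathcomp Require Import all_boot all_order all_algebra.
From mathcomp Require Import zify.
From Stdlib Require Import Relation_Operators Operators_Properties.

Set Implicit Arguments.
Unset Strict Implicit.
Unset Printing Implicit Defensive.

Import Order.TTheory GRing.Theory Num.Theory.

(** * Bases, coloops, cyclic sets and the h-polynomial *)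

Section Bases.
Variables (E : finType) (M : matroid E).
Implicit Types (I J B : {set E}) (e x : E).

Definition basis B := indep M B && (#|B| == rank M).

Definition coloops : {set E} := [set x | [forall B, basis B ==> (x \in B)]].

Lemma coloopsP x : reflect (forall B, basis B -> x \in B) (x \in coloops).
Proof.
rewrite inE; apply: (iffP forallP) => h B; last exact/implyP/h.
exact: (implyP (h B)).
Qed.

Lemma indep_rank I : indep M I -> #|I| <= rank M.
Proof. by move=> iI; rewrite /rank; apply: leq_bigmax_cond. Qed.

Lemma exists_basis : exists B, basis B.
Proof.
have : 0 < #|[pred I : {set E} | indep M I]|.
  by apply/card_gt0P; exists set0; rewrite inE indep_set0.
case/(eq_bigmax_cond (fun I : {set E} => #|I|)) => B iB eB.
by exists B; rewrite /basis /rank eB eqxx andbT.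
Qed.

Lemma indep_extend I J : indep M I -> indep M J -> #|I| <= #|J| ->
  exists2 K, indep M K & [/\ I \subset K, K \subset I :|: J & #|K| = #|J|].
Proof.
move=> + iJ; elim: {I}_.+1 {-2}I (ltnSn (#|J| - #|I|)) => // n IHn I.
rewrite ltnS => le_n iI; rewrite leq_eqVlt => /orP[/eqP eIJ|lt_IJ].
  by exists I => //; rewrite subsetUl.
have [e] := indep_aug iI iJ lt_IJ; rewrite inE => /andP[eI eJ] ieI.
have ceI : #|e |: I| = #|I|.+1 by rewrite cardsU1 eI.
have [||K iK [sK sK' cK]] := IHn _ _ ieI; try by rewrite ceI; lia.
exists K => //; split=> //; first exact: subset_trans (subsetUr _ _) sK.
by apply: subset_trans sK' _; rewrite -setUA subUset sub1set inE eJ orbT /=.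
Qed.

Lemma extend_basis I B : indep M I -> basis B ->
  exists2 K, basis K & I \subset K /\ K \subset I :|: B.
Proof.
move=> iI /andP[iB /eqP cB].
have [|K iK [sI sK cK]] := indep_extend iI iB; first by rewrite cB indep_rank.
by exists K; rewrite ?/basis ?iK ?cK ?cB /=.
Qed.

(* [X] is a union of circuits iff each of its points is spanned by the other
   ones; this form avoids building circuits of the minors. *)
Definition cyclic_set (X : {set E}) : Prop :=
  forall x, x \in X -> exists2 I : {set E}, I \subset X &
    [/\ x \notin I, indep M I & ~~ indep M (x |: I)].

Lemma cycle_cyclic_set X : Defs.cycle M X -> cyclic_set X.
Proof.
case=> S cS -> x /bigcupP[K KS xK].
have /minsetP[dK minK] := cS _ KS.
exists (K :\ x); first by apply/(subset_trans (subD1set _ _))/bigcup_sup.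
rewrite !inE eqxx setD1K //; split=> //.
apply: contraT => /minK /(_ (subD1set _ _)) /setP /(_ x).
by rewrite !inE eqxx xK.
Qed.

(** An independent subset of [X] that spans [e] extends to a basis inside its union with [B]. That
    basis omits [e], since the subset together with [e] is dependent. *)
Lemma cyclic_set_spanned X e B : cyclic_set X -> e \in X -> basis B ->
  exists2 K, basis K & e \notin K /\ K \subset X :|: B.
Proof.
move=> cX /cX[I sI [eI iI dI]] /(extend_basis iI)[K bK [sIK sK]].
exists K => //; split; last by apply: subset_trans sK _; rewrite setSU.
apply: contra dI => eK; apply: (@indep_sub _ _ _ K); last by case/andP: bK.
by rewrite subUset sub1set eK.
Qed.

Lemma cyclic_set_coloop X e : cyclic_set X -> e \in X -> e \notin coloops.
Proof.
move=> cX eX; have [B /(cyclic_set_spanned cX eX)[K bK [eK _]]] := exists_basis.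
by apply: contra eK => /coloopsP/(_ K bK).
Qed.

Local Open Scope ring_scope.

Lemma h_polyE :
  h_poly M = \sum_(I | indep M I) ('X - 1) ^+ (rank M - #|I|).
Proof.
rewrite /h_poly; under eq_bigr => i _ do
  rewrite scaler_nat -sumr_const.
rewrite (partition_big (fun I : {set E} => inord #|I| : 'I_(rank M).+1) xpredT) //=.
apply: eq_bigr => i _; apply: eq_big => I.
  rewrite inE; case: (boolP (indep M I)) => //= iI.
  by rewrite -val_eqE /= inordK // ltnS indep_rank.
by rewrite inE => /andP[_ /eqP->].
Qed.

Lemma size_h_poly : (size (h_poly M) <= (rank M).+1)%N.
Proof.
apply/(leq_trans (size_sum _ _ _))/bigmax_leqP => i _.
apply: leq_trans (size_scale_leq _ _) _.
by rewrite -polyC1 size_exp_XsubC ltnS leq_subr.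
Qed.

End Bases.

(** * Deletion and contraction of a point *)

Section Minors.
Variables (E : finType) (M : matroid E) (e : E).
Implicit Types (I J B X : {set E}) (x : E).

(* The minors keep the ground type [E]; the point [e] becomes a loop. *)
Definition del_indep : pred {set E} := fun I => (e \notin I) && indep M I.

Lemma del_indep0 : del_indep set0.
Proof. by rewrite /del_indep inE indep_set0. Qed.

Lemma del_indep_sub I J : I \subset J -> del_indep J -> del_indep I.
Proof.
move=> sIJ /andP[eJ iJ]; rewrite /del_indep (indep_sub sIJ iJ) andbT.
by apply: contra eJ; apply: (subsetP sIJ).
Qed.

Lemma del_indep_aug I J : del_indep I -> del_indep J -> #|I| < #|J| ->
  exists2 x, x \in J :\: I & del_indep (x |: I).
Proof.
case/andP=> eI iI /andP[eJ iJ] /(indep_aug iI iJ)[x xJ ix].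
exists x => //; rewrite /del_indep ix andbT !inE negb_or eI andbT.
by apply: contraNneq eJ => ->; case/setDP: xJ.
Qed.

Definition deletion := Matroid del_indep0 del_indep_sub del_indep_aug.

Hypothesis nonloop : indep M [set e].

Definition con_indep : pred {set E} :=
  fun I => (e \notin I) && indep M (e |: I).

Lemma con_indep0 : con_indep set0.
Proof. by rewrite /con_indep inE setU0. Qed.

Lemma con_indep_sub I J : I \subset J -> con_indep J -> con_indep I.
Proof.
move=> sIJ /andP[eJ iJ]; rewrite /con_indep (indep_sub _ iJ) ?setUS // andbT.
by apply: contra eJ; apply: (subsetP sIJ).
Qed.

Lemma con_indep_aug I J : con_indep I -> con_indep J -> #|I| < #|J| ->
  exists2 x, x \in J :\: I & con_indep (x |: I).
Proof.
case/andP=> eI iI /andP[eJ iJ] lt_IJ.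
have [|x] := indep_aug iI iJ; first by rewrite !cardsU1 eI eJ.
rewrite !inE negb_or => /andP[/andP[xe xI]]; rewrite (negPf xe) /= => xJ ix.
exists x; first by rewrite inE xI.
by rewrite /con_indep setUCA ix andbT !inE negb_or eI eq_sym xe.
Qed.

Definition contraction := Matroid con_indep0 con_indep_sub con_indep_aug.

Lemma cyclic_set_deletion X :
  e \notin X -> cyclic_set M X -> cyclic_set deletion X.
Proof.
move=> eX cX x xX; have [I sI [xI iI dI]] := cX x xX.
exists I => //; split=> //=; rewrite /del_indep ?negb_and ?iI ?dI ?orbT //.
by rewrite andbT; apply: contra eX; apply: (subsetP sI).
Qed.

Lemma cyclic_set_contraction X :
  cyclic_set M X -> cyclic_set contraction (X :\ e).
Proof.
move=> cX x /setD1P[xe xX]; have [I sI [xI iI dI]] := cX x xX.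
have [ieI|deI] := boolP (indep M (e |: I)).
  exists (I :\ e); first exact: setSD.
  rewrite /= /con_indep !inE eqxx (negPf xI) andbF [e == x]eq_sym (negPf xe) /=.
  split=> //; first by apply: indep_sub ieI; rewrite setUS ?subD1set.
  apply: contra dI; apply: indep_sub; apply/subsetP => y; rewrite !inE.
  by case: (y == e); case: (y == x).
(* Here [I] spans [e], so [e] can be exchanged for a point of [I]. The resulting [J] still spans
   [x]: augmenting [I] from an independent [x |: J] would add [x] or [e]. *)
have lt0I : #|[set e]| <= #|I|.
  rewrite cards1 card_gt0; apply: contraNneq deI => ->.
  by rewrite setU0.
have [J iJ [eJ sJ cJ]] := indep_extend nonloop iI lt0I.
rewrite sub1set in eJ.
have xJ : x \notin J.
  by apply/negP => /(subsetP sJ); rewrite !inE (negPf xe) (negPf xI).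
exists (J :\ e).
  apply/subsetP => y; rewrite !inE => /andP[ye /(subsetP sJ)].
  by rewrite !inE (negPf ye) /= => /(subsetP sI).
rewrite /= /con_indep !inE eqxx (negPf xJ) andbF [e == x]eq_sym (negPf xe) /=.
rewrite setUCA setD1K //; split=> //; apply/negP => ixJ.
have [|y] := indep_aug iI ixJ; first by rewrite cardsU1 xJ cJ.
rewrite !inE => /andP[yI /orP[/eqP->|yJ]]; first by rewrite (negPf dI).
have := subsetP sJ _ yJ; rewrite !inE (negPf yI) orbF => /eqP->.
by rewrite (negPf deI).
Qed.

Hypothesis noncoloop : e \notin coloops M.

Lemma rank_deletion : rank deletion = rank M.
Proof.
apply/eqP; rewrite eqn_leq; apply/andP; split.
  by apply/bigmax_leqP => I /andP[_]; apply: indep_rank.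
move: noncoloop; rewrite inE negb_forall => /existsP[B].
rewrite negb_imply => /andP[/andP[iB /eqP <-] eB].
by apply: (@indep_rank _ deletion); rewrite /= /del_indep eB.
Qed.

Lemma basis_deletion B : basis deletion B = (e \notin B) && basis M B.
Proof. by rewrite /basis rank_deletion /= /del_indep andbA. Qed.

Lemma rank_contraction : rank M = (rank contraction).+1.
Proof.
apply/eqP; rewrite eqn_leq; apply/andP; split.
  have [B bB] := exists_basis M.
  have [K /andP[iK /eqP <-] [eK _]] := extend_basis nonloop bB.
  rewrite sub1set in eK; rewrite (cardsD1 e) eK ltnS.
  by apply: (@indep_rank _ contraction); rewrite /= /con_indep !inE eqxx setD1K.
have [B /andP[/andP[eB iB] /eqP <-]] := exists_basis contraction.
by have := indep_rank iB; rewrite cardsU1 eB.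
Qed.

Lemma basis_contraction B :
  basis contraction B = (e \notin B) && basis M (e |: B).
Proof.
rewrite /basis rank_contraction /= /con_indep -andbA.
by case eB: (e \in B) => //=; rewrite cardsU1 eB.
Qed.

(** Bases of the contraction are the bases of [M] through [e] with [e] removed, and any basis [B] of
    [M] can be exchanged for one through [e] inside [e |: B]. *)
Lemma coloops_contraction : coloops contraction = coloops M.
Proof.
apply/setP => x; apply/coloopsP/coloopsP => cx B.
  have [D bD] := exists_basis contraction.
  have xe : x != e.
    apply: contraTneq (cx D bD) => ->.
    by move: bD; rewrite basis_contraction => /andP[].
  case/(extend_basis nonloop) => K bK [eK sK]; rewrite sub1set in eK.
  have /cx : basis contraction (K :\ e).
    by rewrite basis_contraction !inE eqxx setD1K.
  by case/setD1P => _ /(subsetP sK); rewrite !inE (negPf xe).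
rewrite basis_contraction => /andP[eB /cx]; rewrite !inE => /orP[/eqP xe|//].
by case/negP: noncoloop; rewrite -xe; apply/coloopsP.
Qed.

Lemma coloops_deletion : coloops M \subset coloops deletion.
Proof.
apply/subsetP => x /coloopsP cx; apply/coloopsP => B.
by rewrite basis_deletion => /andP[_ /cx].
Qed.

(* The set [e, f] is then a cocircuit, so it cannot meet a circuit in the
   single point [e]. *)
Lemma new_coloop_mem X f : f \in coloops deletion -> f \notin coloops M ->
  cyclic_set M X -> e \in X -> f \in X.
Proof.
move=> /coloopsP cf nf cX eX; apply: contraT => fX.
move: nf; rewrite inE negb_forall => /existsP[B].
rewrite negb_imply => /andP[bB fB].
have [K bK [eK sK]] := cyclic_set_spanned cX eX bB.
have /cf /(subsetP sK) : basis deletion K by rewrite basis_deletion eK.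
by rewrite inE (negPf fX) (negPf fB).
Qed.

Local Open Scope ring_scope.

(** The independent sets split by whether they contain [e]. Exponents match: deletion keeps the
    rank, while contraction lowers the rank and the size of the set by one each. *)
Lemma h_poly_deletion_contraction :
  h_poly M = h_poly deletion + h_poly contraction.
Proof.
rewrite !h_polyE (bigID (fun I : {set E} => e \in I)) /= addrC; congr (_ + _).
  by apply: eq_big => [I|I _]; rewrite ?rank_deletion // andbC.
rewrite (reindex_onto (fun I => e |: I) (fun I => I :\ e)) /=; last first.
  by move=> I /andP[_ /setD1K].
apply: eq_big => [I|I].
  rewrite /con_indep setU11 andbT andbC; congr (_ && _).
  apply/eqP/idP => [<-|eI]; first by rewrite !inE eqxx.
  by rewrite setU1K.
case/andP=> _ /eqP eIK; have eI : e \notin I by rewrite -eIK !inE eqxx.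
by rewrite rank_contraction cardsU1 eI subSS.
Qed.

Lemma h_vector_deletion_contraction k :
  h_vector M k =
  h_vector deletion k + (if k is k'.+1 then h_vector contraction k' else 0).
Proof.
rewrite /h_vector rank_deletion h_poly_deletion_contraction coefD.
have := size_h_poly contraction; rewrite -rank_contraction => sz.
(* For [k = 0] the coefficient of the contraction's polynomial is read at [rank M], one past its
   largest possible degree, so it is zero. *)
case: k => [|k]; first by rewrite subn0 addr0 /= [X in _ + X]nth_default ?addr0.
by rewrite rank_contraction subSS ltnS; case: ifP; rewrite ?addr0.
Qed.

End Minors.

(** * Unique unions and coparking functions on a subset of indices *)

Section UniqueUnion.
Variables (E : finType) (g : nat).
Implicit Types (C : 'I_g -> {set E}) (e f x : E) (i j : 'I_g).
Implicit Types (T sigma : {set 'I_g}) (a b : {ffun 'I_g -> nat}).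

Definition owner C T e j :=
  [/\ j \in T, e \in C j & forall i, i \in T -> e \in C i -> i = j].

Lemma unique_unionP C T e :
  reflect (exists j, owner C T e j) (e \in unique_union C T).
Proof.
rewrite inE; apply: (iffP cards1P) => [[j eT]|[j [jT ej ej_only]]]; exists j.
  have mT i : (i \in T) && (e \in C i) = (i == j).
    by rewrite -in_set1 -eT inE.
  have /andP[jT ej] : (j \in T) && (e \in C j) by rewrite mT.
  by split=> // i iT ei; apply/eqP; rewrite -mT iT.
apply/setP => i; rewrite !inE; apply/andP/eqP => [[]|->//]; exact: ej_only.
Qed.

Lemma owner_sub C T sigma e j :
  owner C T e j -> sigma \subset T -> j \in sigma -> owner C sigma e j.
Proof. by case=> _ ej ej_only /subsetP sT js; split=> // i /sT /ej_only. Qed.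

Lemma owner_notin C T e i j : owner C T e j -> i \in T :\ j -> e \notin C i.
Proof.
case=> _ _ ej_only /setD1P[ij iT]; apply: contra ij => /(ej_only _ iT) ->.
by rewrite eqxx.
Qed.

(** A point of [C i] covered exactly once by [T] is covered by [i] alone, and this persists in every
    subset that keeps [i]. *)
Lemma unique_union_antimono C T sigma i :
  i \in sigma -> sigma \subset T ->
  C i :&: unique_union C T \subset C i :&: unique_union C sigma.
Proof.
move=> iS sT; apply/subsetP => x /setIP[xi /unique_unionP[j oj]].
rewrite inE xi; apply/unique_unionP; exists j; apply: (owner_sub oj) => //.
by have [_ _ /(_ i (subsetP sT i iS) xi) <-] := oj.
Qed.

Lemma unique_union_setD1 C T e :
  unique_union (fun i => C i :\ e) T = unique_union C T :\ e.
Proof.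
apply/setP => x; apply/unique_unionP/setD1P.
  case=> j [jT /setD1P[xe xj] xj_only]; split=> //; apply/unique_unionP.
  by exists j; split=> // i iT xi; apply: xj_only; rewrite // !inE xe.
case=> xe /unique_unionP[j [jT xj xj_only]]; exists j; split=> //.
  by rewrite !inE xe.
by move=> i iT /setD1P[_]; apply: xj_only.
Qed.

(** The point [e] lies in [C i :&: unique_union C sigma] exactly when [i = j], so removing it costs
    one there and nothing elsewhere. *)
Lemma card_unique_union_setD1 C T sigma e i j :
  owner C T e j -> sigma \subset T -> i \in sigma ->
  #|C i :&: unique_union C sigma| =
  #|(C i :\ e) :&: unique_union (fun i => C i :\ e) sigma| + (i == j).
Proof.
move=> oj sT iS; rewrite unique_union_setD1 (cardsD1 e) addnC; congr (_ + _).
  by apply: eq_card => x; rewrite !inE; case: (x == e).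
congr (nat_of_bool _); rewrite inE; apply/andP/eqP.
  by have [_ _ ej_only] := oj => -[/ej_only-> //]; apply: (subsetP sT).
move=> ij; rewrite ij in iS *; split; first by case: oj.
by apply/unique_unionP; exists j; apply: owner_sub oj _ _.
Qed.

(** Restricting to subsets of [T], with zero entries outside, lets the induction drop a cycle while
    the index type stays fixed. *)
Definition parking_on C T : pred {ffun 'I_g -> nat} := fun a =>
  [forall sigma : {set 'I_g}, (sigma != set0) && (sigma \subset T) ==>
    [exists i in sigma, a i < #|C i :&: unique_union C sigma|]] &&
  [forall i, (i \notin T) ==> (a i == 0)].

Lemma parking_onP C T a :
  reflect ((forall sigma, sigma != set0 -> sigma \subset T ->
            exists2 i, i \in sigma & a i < #|C i :&: unique_union C sigma|) /\
           (forall i, i \notin T -> a i = 0))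
          (parking_on C T a).
Proof.
apply: (iffP andP) => [[/forallP h1 /forallP h2]|[h1 h2]]; split.
- move=> sigma s0 sT; apply/exists_inP.
  by have := h1 sigma; rewrite s0 sT.
- by move=> i iT; apply/eqP; have := h2 i; rewrite iT.
- by apply/forallP => sigma; apply/implyP => /andP[s0 sT]; apply/exists_inP/h1.
- by apply/forallP => i; apply/implyP => iT; rewrite h2.
Qed.

Lemma coparkingE C : coparking C =1 parking_on C setT.
Proof.
move=> a; apply/forallP/parking_onP => [h|[h _] sigma].
  split=> [sigma s0 _|i]; last by rewrite inE.
  by apply/exists_inP; have := h sigma; rewrite s0.
by apply/implyP => s0; apply/exists_inP/h.
Qed.

Lemma parking_on_le C T a b :
  vec_le a b -> parking_on C T b -> parking_on C T a.
Proof.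
move=> le_ab /parking_onP[h1 h2]; apply/parking_onP; split=> [sigma s0 sT|i iT].
  by have [i iS lti] := h1 sigma s0 sT; exists i; rewrite // (leq_ltn_trans _ lti).
by apply/eqP; rewrite -leqn0 -(h2 i iT).
Qed.

(** Whenever [sigma] contains [j], the point [e] makes the bound at [j] positive, so [a j = 0] meets
    it. Only the sets avoiding [j] impose a condition. *)
Lemma parking_on_delete C T e j a : owner C T e j -> a j = 0 ->
  parking_on C T a = parking_on C (T :\ j) a.
Proof.
move=> oj aj; apply/parking_onP/parking_onP => -[h1 h2].
  split=> [sigma s0 sT|i].
    by apply: h1 => //; apply: subset_trans sT (subD1set _ _).
  by rewrite !inE negb_and negbK => /orP[/eqP->|/h2].
split=> [sigma s0 sT|i iT]; last by apply: h2; rewrite !inE negb_and iT orbT.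
have [jS|jS] := boolP (j \in sigma); last by apply: h1; rewrite // subsetD1 sT.
exists j => //; rewrite aj card_gt0; apply/set0Pn; exists e.
rewrite inE; apply/andP; split; first by case: oj.
by apply/unique_unionP; exists j; apply: owner_sub oj sT jS.
Qed.

Definition incr (j : 'I_g) (a : {ffun 'I_g -> nat}) : {ffun 'I_g -> nat} :=
  [ffun i => a i + (i == j)].

Lemma incr_inj j : injective (incr j).
Proof.
move=> a b /ffunP eab; apply/ffunP => i; have := eab i.
by rewrite !ffunE => /addIn.
Qed.

Lemma incr_pred j a : 0 < a j -> exists b, a = incr j b.
Proof.
move=> aj; exists [ffun i => a i - (i == j)]; apply/ffunP => i.
by rewrite !ffunE subnK //; case: eqP => // ->.
Qed.

Lemma deg_incr j a : deg (incr j a) = (deg a).+1.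
Proof.
rewrite /deg (eq_bigr (fun i => a i + (i == j))) => [|i _]; last by rewrite ffunE.
by rewrite big_split /= -big_mkcond /= big_pred1_eq addn1.
Qed.

Lemma parking_on_incr C T e j a : owner C T e j ->
  parking_on C T (incr j a) = parking_on (fun i => C i :\ e) T a.
Proof.
move=> oj; apply/parking_onP/parking_onP => -[h1 h2];
  split=> [sigma s0 sT|i iT].
- have [i iS] := h1 sigma s0 sT; move=> lti; exists i => //; move: lti.
  by rewrite ffunE (card_unique_union_setD1 oj sT iS) ltn_add2r.
- by have /eqP := h2 i iT; rewrite ffunE addn_eq0 => /andP[/eqP].
- have [i iS lti] := h1 sigma s0 sT; exists i => //.
  by rewrite ffunE (card_unique_union_setD1 oj sT iS) ltn_add2r.
- rewrite ffunE h2 //; case: eqP iT => // ->.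
  by case: oj => ->.
Qed.

(** A point owned by [j] is no coloop, so deleting it keeps the rank while [T] and [S] lose one
    element each. The remaining sets avoid the point and stay cyclic. *)
Lemma cyclic_family_corank (M : matroid E) (S : {set E}) C T :
  (forall I, indep M I -> I \subset S) ->
  (forall i, i \in T -> C i \subset S /\ cyclic_set M (C i)) ->
  (forall sigma, sigma != set0 -> sigma \subset T -> unique_union C sigma != set0) ->
  #|T| + rank M <= #|S|.
Proof.
elim: {T}_.+1 {-2}T (ltnSn #|T|) M S => // n IHn T le_n M S indS cycC uuC.
have [->|T0] := eqVneq T set0.
  rewrite cards0; have [B /andP[iB /eqP <-]] := exists_basis M.
  exact/subset_leq_card/indS.
have /set0Pn[e /unique_unionP[j oj]] := uuC T T0 (subxx T).
have [jT ej _] := oj; have [sCj cCj] := cycC j jT.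
rewrite -(rank_deletion (cyclic_set_coloop cCj ej)).
rewrite (cardsD1 j) jT (cardsD1 e S) (subsetP sCj _ ej) -addnA leq_add2l.
apply: IHn => [|I|i iT|sigma s0 sT].
- by move: le_n; rewrite (cardsD1 j) jT.
- by rewrite subsetD1 => /andP[-> /indS ->].
- have eCi := owner_notin oj iT; case/setD1P: iT => _ /cycC[sCi cCi].
  by split; [rewrite subsetD1 sCi | apply: cyclic_set_deletion].
- by apply: uuC => //; apply: subset_trans sT (subD1set _ _).
Qed.

(* If [a j] were positive, the sets [C i :\ e] would be too many cycles with
   nonempty unique unions for the corank left after deleting [e]. *)
Lemma parking_on_loop (M : matroid E) (S : {set E}) C T e j a :
  (forall I, indep M I -> I \subset S) ->
  #|T| + rank M = #|S| ->
  (forall i, i \in T -> C i \subset S /\ cyclic_set M (C i)) ->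
  ~~ indep M [set e] -> owner C T e j -> parking_on C T a -> a j = 0.
Proof.
move=> indS cardT cycC loop_e oj pa.
have eI I : indep M I -> e \notin I.
  by move=> iI; apply: contra loop_e => eI; apply: indep_sub iI; rewrite sub1set.
have [jT ej _] := oj; have eS : e \in S by apply: (subsetP (cycC j jT).1).
have [->//|aj0] := posnP (a j); have [b ab] := incr_pred aj0.
move: pa; rewrite ab (parking_on_incr _ oj) => /parking_onP[h _].
suff: #|T| + rank M <= #|S :\ e|.
  by rewrite cardT (cardsD1 e) eS add1n ltnn.
apply: (@cyclic_family_corank M _ (fun i => C i :\ e)).
- by move=> I iI; rewrite subsetD1 indS ?eI.
- move=> i /cycC[sCi cCi]; split; first exact: setSD.
  move=> x /setD1P[_ /cCi[I sI [xI iI dI]]]; exists I => //.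
  by rewrite subsetD1 sI eI.
- move=> sigma s0 sT; have [i _] := h sigma s0 sT.
  apply: contraTneq => ->; by rewrite setI0 cards0.
Qed.

End UniqueUnion.

(** * The induction: matroids without circuits on [S], then deletion and contraction *)

Section Free.
Variables (E : finType) (M : matroid E) (S : {set E}).
Hypothesis indS : forall I, indep M I -> I \subset S.
Hypothesis rankS : rank M = #|S|.

Lemma free_indep I : indep M I = (I \subset S).
Proof.
apply/idP/idP => [/indS //|sI]; apply: indep_sub sI _.
have [B /andP[iB /eqP cB]] := exists_basis M.
suff <- : B = S by [].
by apply/eqP; rewrite eqEcard indS //= cB rankS.
Qed.

Lemma free_coloops : coloops M = S.
Proof.
apply/setP => x; apply/coloopsP/idP => [h|xS B /andP[iB /eqP cB]].
  by apply: h; rewrite /basis free_indep subxx rankS eqxx.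
suff -> : B = S by [].
by apply/eqP; rewrite eqEcard indS //= cB rankS.
Qed.

Local Open Scope ring_scope.

Lemma free_h_vector k : h_vector M k = (k == 0)%:R.
Proof.
have hX : h_poly M = 'X^(rank M).
  (* Binomial theorem for [('X - 1) + 1]: its coefficients count the subsets of [S], all of which
     are independent. *)
  rewrite -[in RHS](subrK 1 'X) exprDn; apply: eq_bigr => i _.
  rewrite expr1n mulr1 scaler_nat; congr (_ *+ _).
  rewrite [X in 'C(X, _)]rankS -cards_draws; apply: eq_card => I.
  by rewrite !inE free_indep.
rewrite /h_vector hX coefXn; case: leqP => [le_k|]; last by case: k.
by congr (nat_of_bool _)%:R; lia.
Qed.

End Free.

(** The set [S] is the ground set proper, since points removed in minors survive in [E] as loops;
    [#|T|] is the corank on [S]. Purity is stated through the exact degree of maximal elements,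
    which can be compared across both minors. *)
Lemma parking_on_h_vector (E : finType) (g : nat) (M : matroid E) (S : {set E})
    (C : 'I_g -> {set E}) (T : {set 'I_g}) :
  (forall I, indep M I -> I \subset S) ->
  #|T| + rank M = #|S| ->
  (forall i, i \in T -> C i \subset S /\ cyclic_set M (C i)) ->
  (forall sigma, sigma != set0 -> sigma \subset T ->
     dependent M (unique_union C sigma)) ->
  (exists s, [/\ uniq s, forall a, (a \in s) = parking_on C T a &
     forall k, Posz (count (fun a => deg a == k) s) = h_vector M k]) /\
  (forall a, maximal (parking_on C T) a -> deg a + #|coloops M| = rank M).
Proof.
elim: {S}_.+1 {-2}S (ltnSn #|S|) M C T => // n IHn S le_n M C T indS cardT cycC depC.
have [T0|T0] := eqVneq T set0.
  have rankS : rank M = #|S| by rewrite -cardT T0 cards0.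
  have P0 a : parking_on C T a = (a == [ffun=> 0]).
    rewrite T0; apply/parking_onP/eqP => [[_ h]|->].
      by apply/ffunP => i; rewrite ffunE h ?inE.
    split=> [sigma s0|i _]; last by rewrite ffunE.
    by rewrite subset0 (negPf s0).
  have deg0 : deg ([ffun=> 0] : {ffun 'I_g -> nat}) = 0.
    by rewrite /deg big1 // => i _; rewrite ffunE.
  split; last first.
    by move=> a []; rewrite P0 => /eqP-> _; rewrite deg0 (free_coloops indS rankS).
  exists [:: [ffun=> 0]]; split=> // [a|k]; first by rewrite inE P0.
  by rewrite /= deg0 addn0 (free_h_vector indS rankS) eq_sym; case: eqP.
have /set0Pn[e /unique_unionP[j oj]] : unique_union C T != set0.
  by apply: contraTneq (depC T T0 (subxx T)) => ->; rewrite /dependent indep_set0.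
have [jT ej _] := oj; have [sCj cCj] := cycC j jT.
have eS : e \in S by apply: (subsetP sCj).
have cardS : #|S| = #|S :\ e|.+1 by rewrite (cardsD1 e) eS.
have cardTj : #|T| = #|T :\ j|.+1 by rewrite (cardsD1 j) jT.
have le_Se : #|S :\ e| < n by rewrite cardS in le_n.
have sTj (sigma : {set 'I_g}) : sigma \subset T :\ j -> sigma \subset T.
  by move=> sT; apply: subset_trans sT (subD1set _ _).
have aj0 a : parking_on C (T :\ j) a -> a j = 0.
  by move=> /parking_onP[_]; apply; rewrite !inE eqxx.
(* If [e] is a loop, [a j] is forced to be zero, and the induction applies to [M] itself with [e]
   dropped from [S]. *)
have [nl|loop_e] := boolP (indep M [set e]); last first.
  have eqPT : parking_on C T =1 parking_on C (T :\ j).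
    move=> a; apply/idP/idP => pa.
      rewrite -(parking_on_delete oj) //.
      exact: (parking_on_loop indS cardT cycC loop_e oj pa).
    by rewrite (parking_on_delete oj) // aj0.
  have [|||||[s [us sP sh]] pureP] := IHn (S :\ e) _ M C (T :\ j).
  - by [].
  - move=> I iI; rewrite subsetD1 indS //; apply: contra loop_e => eI.
    by apply: indep_sub iI; rewrite sub1set.
  - by move: cardT; rewrite cardS cardTj => -[].
  - move=> i iT; have eCi := owner_notin oj iT.
    by case/setD1P: iT => _ /cycC[sCi cCi]; rewrite subsetD1 sCi.
  - by move=> sigma s0 /sTj; apply: depC.
  split; first by exists s; split=> // a; rewrite eqPT.
  move=> a [pa maxa]; apply: pureP; split; first by rewrite -eqPT.
  by move=> b; rewrite -eqPT; apply: maxa.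
have nc : e \notin coloops M := cyclic_set_coloop cCj ej.
have rankM := rank_contraction nl.
have [|||||[s0 [us0 s0P s0h]] pure0] := IHn (S :\ e) _ (deletion M e) C (T :\ j).
- by [].
- by move=> I /andP[eI /indS sI]; rewrite subsetD1 sI.
- by move: cardT; rewrite cardS cardTj rank_deletion // => -[].
- move=> i iT; have eCi := owner_notin oj iT.
  case/setD1P: iT => _ /cycC[sCi cCi].
  by split; [rewrite subsetD1 sCi | apply: cyclic_set_deletion].
- move=> sigma s0 /sTj sT; have := depC sigma s0 sT.
  by rewrite /dependent /= /del_indep negb_and orbC => ->.
have [|||||[s1 [us1 s1P s1h]] pure1] :=
  IHn (S :\ e) _ (contraction nl) (fun i => C i :\ e) T.
- by [].
- move=> I /andP[eI /indS]; rewrite subUset => /andP[_ sI].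
  by rewrite subsetD1 sI.
- by move: cardT; rewrite cardS rankM addnS => -[].
- move=> i /cycC[sCi cCi].
  by split; [apply: setSD | apply: cyclic_set_contraction].
- move=> sigma s0' sT; apply: contra (depC sigma s0' sT).
  rewrite unique_union_setD1 => /andP[_]; apply: indep_sub.
  by apply/subsetP => x; rewrite !inE; case: (x == e).
split.
  (* The list [s0] holds the functions vanishing at [j], and the images of [s1] are those positive
     at [j], with degree raised by one. *)
  exists (s0 ++ map (incr j) s1); split.
  - rewrite cat_uniq us0 (map_inj_uniq (@incr_inj _ j)) us1 andbT /=.
    apply/hasPn => _ /mapP[b _ ->]; rewrite s0P; apply/negP => /aj0.
    by rewrite ffunE eqxx addn1.
  - move=> a; rewrite mem_cat s0P; have [aj|] := posnP (a j).
      rewrite -(parking_on_delete oj) //; case: parking_on => //=.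
      apply/mapP => -[b _ ab]; move: aj; by rewrite ab ffunE eqxx addn1.
    move=> aj; have [b ab] := incr_pred aj.
    have /negPf-> : ~~ parking_on C (T :\ j) a.
      by apply/negP => /aj0 aj'; rewrite aj' in aj.
    by rewrite /= ab (mem_map (@incr_inj _ j)) s1P (parking_on_incr _ oj).
  - move=> k; rewrite count_cat PoszD s0h count_map.
    rewrite (h_vector_deletion_contraction nl nc); congr (_ + _)%R.
    case: k => [|k]; last first.
      by rewrite -s1h; congr Posz; apply: eq_count => b /=; rewrite deg_incr eqSS.
    by rewrite (eq_count (a2 := pred0)) ?count_pred0 // => b /=; rewrite deg_incr.
(* If [a j] is positive, lowering it by one gives a maximal element for the contraction, whose rank
   is one less and whose coloops are the same. *)
move=> a [pa maxa]; have [aj|aj] := posnP (a j); last first.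
  have [b ab] := incr_pred aj.
  rewrite ab deg_incr addSn rankM -(coloops_contraction nl nc) pure1 //.
  split; first by rewrite -(parking_on_incr _ oj) -ab.
  move=> c pc le_bc; apply: (@incr_inj _ j); rewrite -ab; apply: maxa.
    by rewrite (parking_on_incr _ oj).
  by move=> i; rewrite ab !ffunE leq_add2r.
(* If [a j = 0], then [a] is also maximal for the deletion; it remains to see that deleting [e]
   creates no coloop [f]. *)
have pa' : parking_on C (T :\ j) a by rewrite -(parking_on_delete oj).
rewrite -(rank_deletion nc) -(pure0 a); last first.
  split=> // b pb; apply: maxa.
  by rewrite (parking_on_delete oj) // aj0.
congr (_ + _); apply/eqP; rewrite eqn_leq subset_leq_card ?coloops_deletion //=.
apply/subset_leq_card/subsetP => f cf; apply: contraT => ncf.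
have fe : f != e.
  have [B bB] := exists_basis (deletion M e).
  apply: contraTneq ((coloopsP _ _ cf) B bB) => ->.
  by move: bB; rewrite basis_deletion // => /andP[].
have fj : f \in C j := new_coloop_mem nc cf ncf cCj ej.
(* A set [C i] with [i != j] avoids [e], hence stays cyclic in the deletion and cannot contain its
   coloop [f]. *)
have of_ : owner C T f j.
  split=> // i iT fi; apply/eqP; apply: contraT => ij.
  have iTj : i \in T :\ j by rewrite !inE ij.
  have [_ /(cyclic_set_deletion (owner_notin oj iTj)) cCi] := cycC i iT.
  by have := cyclic_set_coloop cCi fi; rewrite cf.
(* For [sigma] containing [j], both [e] and [f] lie in [C j :&: unique_union C sigma], so the entry
   at [j] may rise from zero to one, against the maximality of [a]. *)
have pa1 : parking_on C T (incr j a).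
  have [h1 h2] := parking_onP _ _ _ pa; apply/parking_onP; split.
    move=> sigma sn0 sT; have [jS|jS] := boolP (j \in sigma); last first.
      have [i iS lti] := h1 sigma sn0 sT; exists i => //.
      by rewrite ffunE; case: eqP iS jS => [-> ->|] //; rewrite addn0.
    exists j => //; rewrite ffunE aj eqxx (cardsD1 e) (cardsD1 f) !inE fe ej fj.
    have U x : owner C T x j -> #|[set i in sigma | x \in C i]| == 1.
      move=> ox; suff : x \in unique_union C sigma by rewrite inE.
      by apply/unique_unionP; exists j; apply: owner_sub ox sT jS.
    by rewrite (U _ oj) (U _ of_).
  move=> i iT; rewrite ffunE h2 //; case: eqP iT => // ->.
  by rewrite jT.
have /ffunP/(_ j) : incr j a = a by apply: maxa => // i; rewrite ffunE leq_addr.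
by rewrite ffunE eqxx aj.
Qed.

(** * Termination and correctness of the Dhar-type algorithm *)

Section Dhar.
Variables (E : finType) (g : nat) (C : 'I_g -> {set E}).
Variable a : {ffun 'I_g -> nat}.
Implicit Types sigma tau : {set 'I_g}.

Lemma dhar_always_terminates : dhar_terminates C a.
Proof.
rewrite /dhar_terminates; move: [set: 'I_g] => sigma.
have [n le_n] := ubnP #|sigma|; elim: n sigma le_n => [sigma|n IHn sigma le_n];
  first by rewrite ltn0.
have accO b : Acc (fun s' s => dhar_step C a s s') (Output b).
  by constructor => s' st; inversion st.
constructor => s' st; inversion st as [sg i iS lti| |]; try exact: accO.
by apply: IHn; move: le_n; rewrite (cardsD1 i) iS.
Qed.

(** Ensures that every final state is an output. *)
Lemma dhar_progress sigma : exists s', dhar_step C a (Running sigma) s'.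
Proof.
have [->|s0] := eqVneq sigma set0; first by exists (Output true); constructor.
have [/exists_inP[i iS lti]|] :=
  boolP [exists i in sigma, a i < #|C i :&: unique_union C sigma|].
  by exists (Running (sigma :\ i)); constructor.
rewrite negb_exists_in => /forall_inP h; exists (Output false); constructor=> //.
by move=> i /h /negP.
Qed.

(* If [sigma] is no longer contained in the current state, its first removed
   index [i] left a state [tau] containing [sigma], and
   [C i :&: unique_union C tau] shrinks as [tau] grows. *)
Lemma dhar_reachable s :
  clos_refl_trans _ (dhar_step C a) (Running setT) s ->
  match s with
  | Running tau => forall sigma, sigma != set0 -> ~~ (sigma \subset tau) ->
      [exists i in sigma, a i < #|C i :&: unique_union C sigma|]
  | Output b => b = coparking C a
  end.
Proof.
move=> /(clos_rt_rtn1 _ _ _ _); elim=> [|s1 s2 st _] //.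
  by move=> sigma _; rewrite subsetT.
case: st => [tau i iT lti IH sigma s0|tau t0 fail _|IH].
- have [sT|sT _] := boolP (sigma \subset tau); last exact: IH.
  rewrite subsetD1 sT /= negbK => iS; apply/exists_inP; exists i => //.
  exact: leq_trans lti (subset_leq_card (unique_union_antimono _ iS sT)).
- apply/esym/forallP => /(_ tau); rewrite t0 => /exists_inP[i iT lti].
  exact: fail iT lti.
- apply/esym/forallP => sigma; apply/implyP => s0; apply: IH => //.
  by rewrite subset0.
Qed.

End Dhar.

Theorem theorem2 (E : finType) (M : matroid E) (C : 'I_(corank M) -> {set E}) :
  cycle_system C ->
  (forall a : {ffun 'I_(corank M) -> nat},
     dhar_terminates C a /\
     (forall s, dhar_final C a s ->
        exists b : bool, s = Output b /\ (b = true <-> coparking C a))) /\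
  (multicomplex (coparking C) /\ pure (coparking C)) /\
  (forall k : nat, Posz (degree_vector (coparking C) k) = h_vector M k).
Proof.
case=> cycC depC; split.
  move=> a; split; first exact: dhar_always_terminates.
  case=> [sigma|b] [reach final].
    by have [s' st] := dhar_progress C a sigma; case: (final s').
  by exists b; split=> //; rewrite (dhar_reachable reach).
(* The subtraction in [corank] is truncated; it is exact because a basis has at most [#|E|]
   points. *)
have card_setT : #|[set: 'I_(corank M)]| + rank M = #|[set: E]|.
  rewrite cardsT card_ord cardsT /corank subnK //.
  have [B /andP[_ /eqP <-]] := exists_basis M; exact: max_card.
have [|i _|sigma s0 _|[s [us sP sh]] pureP] :=
    @parking_on_h_vector _ _ M setT C setT _ card_setT.
- by move=> I _; apply: subsetT.
- by split; [apply: subsetT | apply/cycle_cyclic_set/cycC].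
- exact: depC.
have copE := coparkingE C.
split; last by move=> k; rewrite (@degree_vectorE _ _ s) // => a; rewrite copE.
split; first split.
- by exists s => a; rewrite copE sP.
- by move=> a b le_ab; rewrite !copE; apply: parking_on_le.
have maxE a : maximal (coparking C) a -> maximal (parking_on C setT) a.
  by case=> pa maxa; split=> [|b]; rewrite -copE //; apply: maxa.
move=> a b /maxE/pureP da /maxE/pureP db.
by apply/eqP; rewrite -(eqn_add2r #|coloops M|) da db.
Qed.
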